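(* Let $a\in[-\infty,1)$ and let $F\in\mathcal{A}_a$ be arbitrary, such that the moment generating function $\mathrm{E}_F[e^{\lambda X}]$ is finite for all $\lambda$ in some neighborhood of $0$. Let $\mu\in\mathbb{R}$. (i) $D_{\inf}(F,\mu;\mathcal{A}_a)=D_{\inf}(F,\mu;\mathcal{A})$. (ii) If $\mu<1$ then $D_{\inf}(F,\mu;\mathcal{A})=L_{\max}(F,\mu)$.
   Context: For $a\in(-\infty,1)$, $\mathcal{A}_a$ is the family of all probability distributions on $[a,1]$; $\mathcal{A}=\mathcal{A}_{-\infty}$ is the family of all probability distributions on $(-\infty,1]$. $\mathrm{E}_F[u(X)]$ denotes expectation when $X$ has distribution $F$, and $\mathrm{E}(F)=\mathrm{E}_F[X]$. $D(F\Vert G)$ is the Kullback-Leibler divergence. For $a\in[-\infty,1)$, $$D_{\inf}(F,\mu;\mathcal{A}_a)=\inf_{G\in\mathcal{A}_a:\ \mathrm{E}(G)>\mu}D(F\Vert G)$$ (with $\inf\emptyset=+\infty$), and for $\mu<1$ $$L_{\max}(F,\mu)=\max_{0\le\nu\le \frac{1}{1-\mu}}\mathrm{E}_F[\log(1-(X-\mu)\nu)].$$ *)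

(* Defs.v *)
From HB Require Import structures.
From mathcomp Require Import all_boot all_order all_algebra.
From mathcomp Require Import all_classical all_reals all_analysis.
Set Implicit Arguments.
Unset Strict Implicit.
Unset Printing Implicit Defensive.
Import Order.TTheory GRing.Theory Num.Theory.
Import numFieldNormedType.Exports.
Local Open Scope classical_set_scope.
Local Open Scope ring_scope.
Local Open Scope ereal_scope.
Local Open Scope charge_scope.

Definition prob_on (R : realType) (a : \bar R) : set (probability R R) :=
  [set P | P [set x : R | a <= x%:E <= 1] = 1].

(* Well defined in [\bar R] when the positive part of x is integrable, as it is
   on every [prob_on a]; the value -oo is possible on [prob_on -oo]. *)
Definition mean (R : realType) (P : probability R R) : \bar R :=
  'E_P[(idfun : R -> R)].

(* Since t * log t is bounded below, the negative part of log (dF/dG) is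
   F-integrable, so the integral is never of the form +oo - oo. *)
Definition KL (R : realType) (F G : probability R R) : \bar R :=
  if `[< F `<< G >]
  then \int[F]_x lne (('d (charge_of_finite_measure F) '/d G) x)
  else +oo.

Definition Dinf (R : realType) (F : probability R R) (mu : R)
    (A : set (probability R R)) : \bar R :=
  ereal_inf [set KL F G | G in [set G | A G /\ mu%:E < mean G]].

(* [lne], unlike [ln], has log 0 = -oo: the argument vanishes at x = 1 when
   nu = 1 / (1 - mu). *)
Definition expected_log (R : realType) (F : probability R R) (mu nu : R) : \bar R :=
  \int[F]_x lne (1 - (x - mu) * nu)%R%:E.

Definition Lvalues (R : realType) (F : probability R R) (mu : R) :
    set (\bar R) :=
  [set expected_log F mu nu | nu in [set nu : R | (0 <= nu <= 1 / (1 - mu))%R]].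

(* A supremum; it is a maximum exactly when [Lvalues F mu (Lmax F mu)]. *)
Definition Lmax (R : realType) (F : probability R R) (mu : R) : \bar R :=
  ereal_sup (Lvalues F mu).

(* Main.v *)
Require Import Defs.
From HB Require Import structures.
From mathcomp Require Import all_boot all_order all_algebra.
From mathcomp Require Import all_classical all_reals all_analysis.
From mathcomp Require Import measurable_realfun.
From mathcomp Require Import ring lra.
Import Order.TTheory GRing.Theory Num.Theory.
Import numFieldNormedType.Exports.
Local Open Scope classical_set_scope.
Local Open Scope ring_scope.
Local Open Scope ereal_scope.

(** Everything rests on reading 1 - (x - mu) nu as the wealth of an investor.
    With S(x) = (1 - x) / (1 - mu) and t = nu (1 - mu) in [0, 1], one has, for
    x <= 1,
      1 - (x - mu) nu = (1 - t) + t S(x) = W_t(x),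
    the payoff of a capital of which a fraction t is placed on an asset of
    nonnegative return S and the rest is kept.  Thus Lmax is the optimal growth
    rate E_F[log W_t] of the Kelly criterion, and, for G supported on
    (-oo, 1], the constraint E(G) > mu says that E_G[S] < 1.

    Lmax is at most the infimum: if E_G[S] <= 1 then E_G[W_t] <= 1 for every t,
    and integrating log w <= log f + w / f - 1 against F, where f = dF/dG and
    w = W_t, gives E_F[log W_t] <= KL(F, G) ([expected_lne_le_KL]).

    Lmax is attained: log W_t <= S, so Fatou's lemma applied to S - log W_t
    makes the growth rate upper semicontinuous in t on the compact [0, 1]
    ([exists_log_optimal]).

    The infimum is at most Lmax: moving from an optimal t towards any s
    cannot increase the growth rate, and to first order this says that
    E_F[W_s / W_t] <= 1 ([log_optimal_expected_ratio]).  For s = 0 the measure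
    F / W_t has mass at most 1, and for s = 1 it integrates S to at most 1.
    For q < 1 the measure q F / W_t, completed to a probability G by an atom at
    x = 1, where S vanishes, therefore satisfies E_G[S] <= q < 1, while
    dF/dG <= W_t / q, so that KL(F, G) <= Lmax - log q
    ([exists_near_optimal]).  Let q tend to 1.

    This G lives on the support of F together with the point 1, hence on [a, 1]
    whenever F does.  The infimum over [a, 1] is thus Lmax for each a, which
    gives both claims when mu < 1; when mu >= 1 both infima are over the empty
    set.  The moment generating function enters through the integrability of S
    under F ([integrable_payoff]). *)

Set Implicit Arguments.
Unset Strict Implicit.
Unset Printing Implicit Defensive.

(** * Measurability and integration *)

Section integral_facts.
Context d (T : measurableType d) (R : realType).

Lemma measurable_lne (D : set (\bar R)) : measurable_fun D (@lne R).
Proof.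
move=> mD; apply: (measurability _ (ErealGenCInfty.measurableE R)) => //.
move=> _ [_ [r ->] <-]; rewrite (_ : _ @^-1` _ = `[(expR r)%:E, +oo[%classic).
  by apply: measurableI => //; exact: emeasurable_itv.
apply/seteqP; split => x /=; rewrite !in_itv/= !andbT.
- case: x => [x| |] //=; rewrite ?leey//.
  case: ifPn => // x0; rewrite -ltNge in x0.
  by rewrite !lee_fin -ler_expR lnK.
- case: x => [x| |] //=; rewrite ?leey//.
  rewrite lee_fin => ex; have x0 : (0 < x)%R.
    by rewrite (lt_le_trans _ ex)// expR_gt0.
  by rewrite [(x <= 0)%R]leNgt x0/= lee_fin -ler_expR lnK.
Qed.

(** Inversion is the real power -1 on nonnegative reals, including at 0, where
    both are 0; measurability of powers thus transfers. *)
Lemma measurable_inv_ge0 (f : T -> R) : measurable_fun setT f ->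
  (forall x, 0 <= f x)%R -> measurable_fun setT (fun x => (f x)^-1%R).
Proof.
move=> mf f0; rewrite (_ : (fun x => _) = (fun x => powR (f x) (-1))).
  exact: (measurableT_comp (measurable_powR _)).
by apply/funext => x; rewrite powR_inv1.
Qed.

(** The integral is the difference of those of the positive and negative parts,
    each of which is monotone.  As oo - oo is -oo by convention, subtraction of
    extended reals is monotone too, so the inequality survives for functions
    that are not integrable. *)
Lemma ae_le_integral (mu : {measure set T -> \bar R}) (f g : T -> \bar R) :
  measurable_fun setT f -> measurable_fun setT g ->
  {ae mu, forall x, f x <= g x} -> \int[mu]_x f x <= \int[mu]_x g x.
Proof.
move=> mf mg fg; rewrite integralE [leRHS]integralE leeB//.
- apply: ae_ge0_le_integral => //; [exact: measurable_funepos..|].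
  apply: filterS fg => x fgx _; rewrite !funeposE.
  by rewrite ge_max le_max fgx/= le_max lexx orbT.
- apply: ae_ge0_le_integral => //; [exact: measurable_funeneg..|].
  apply: filterS fg => x fgx _; rewrite !funenegE.
  by rewrite ge_max le_max leeN2 fgx/= le_max lexx orbT.
Qed.

(** The positive part is dominated by [g], and an infinite negative part would
    force the integral to be -oo. *)
Lemma ae_le_integrable (mu : {measure set T -> \bar R}) (f g : T -> \bar R) :
  measurable_fun setT f -> mu.-integrable setT g ->
  {ae mu, forall x, f x <= g x} -> -oo < \int[mu]_x f x ->
  mu.-integrable setT f.
Proof.
move=> mf intg fg fNy; have mg := measurable_int _ intg.
have fpos : \int[mu]_x f^\+ x < +oo.
  apply: le_lt_trans (integral_funepos_lt_pinfty _ intg) => //.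
  apply: ae_ge0_le_integral => //; [exact: measurable_funepos..|].
  apply: filterS fg => x fgx _; rewrite !funeposE.
  by rewrite ge_max le_max fgx/= le_max lexx orbT.
have fneg : \int[mu]_x f^\- x < +oo.
  rewrite ltey; apply/eqP => fneg; move: fNy.
  by rewrite integralE fneg addeNy ltxx.
apply/integrableP; split => //; under eq_integral do
  rewrite -[`|f _|]/((abse \o f) _) fune_abse.
rewrite ge0_integralD//; [|exact: measurable_funepos|exact: measurable_funeneg].
exact: lte_add_pinfty.
Qed.

End integral_facts.

(** * Log-optimal investment: existence *)

(** Also at limits [l <= 0]: there [lne] takes the value -oo, and it is
    continuous because any given bound is beaten near 0. *)
Lemma cvg_lne (R : realType) (u : R^nat) (l : R) :
  u @ \oo --> l -> (fun n => lne (u n)%:E) @ \oo --> lne l%:E.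
Proof.
move=> ul; have [l0|l0] := ltP 0%R l.
  rewrite lne_EFin//; apply: cvg_trans (_ : EFin \o (@ln R \o u) @ \oo --> _).
    apply: near_eq_cvg; near=> n; apply/esym/lne_EFin.
    by near: n; apply: (cvgr_gt l).
  apply: cvg_EFin; first exact: nearW.
  exact: (continuous_cvg _ (continuous_ln l0) ul).
rewrite le0_lneNy ?lee_fin//; apply/cvgeNyPle => M.
have: \forall n \near \oo, (u n < expR M)%R.
  by apply: (cvgr_lt l) => //; rewrite (le_lt_trans l0)// expR_gt0.
apply: filterS => n unM /=; case: ifPn => [_|]; first exact: leNye.
by rewrite -ltNge => un0; rewrite lee_fin -ler_expR lnK// ltW.
Unshelve. all: by end_near. Qed.

Section log_optimal.
Context d (T : measurableType d) (R : realType) (P : probability T R).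
Variable S : T -> R.
Hypothesis S_ge0 : forall x, (0 <= S x)%R.
Hypothesis intS : P.-integrable setT (EFin \o S).

(** The value of a unit capital of which the fraction [t] is invested in an
    asset of return [S]. *)
Definition wealth (t : R) (x : T) : R := (1 - t + t * S x)%R.

Definition growth (t : R) : \bar R := \int[P]_x lne (wealth t x)%:E.

Let mS : measurable_fun setT S.
Proof. exact/measurable_EFinP/(measurable_int _ intS). Qed.

Lemma measurable_wealth t : measurable_fun setT (wealth t).
Proof. by apply: measurable_funD => //; exact: measurable_funM. Qed.

Lemma measurable_lne_wealth t :
  measurable_fun setT (fun x => lne (wealth t x)%:E).
Proof.
apply: measurableT_comp; first exact: measurable_lne.
exact/measurable_EFinP/measurable_wealth.
Qed.

Lemma wealth_ge0 t x : (0 <= t <= 1)%R -> (0 <= wealth t x)%R.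
Proof. by move=> /andP[t0 t1]; rewrite addr_ge0 ?subr_ge0 ?mulr_ge0. Qed.

Lemma growth0 : growth 0 = 0.
Proof.
rewrite /growth /wealth; under eq_integral do rewrite subr0 mul0r addr0 lne1.
exact: integral0.
Qed.

Lemma lne_wealth_le t x : (0 <= t <= 1)%R ->
  lne (wealth t x)%:E <= (S x)%:E.
Proof.
move=> t01; have -> : (wealth t x)%:E = 1 + (t * (S x - 1))%:E.
  by rewrite -EFinD /wealth; congr (_%:E); ring.
have tS : (-1 <= t * (S x - 1))%R by have := S_ge0 x; nra.
apply: (le_trans (le_lne1Dx _)); first by rewrite lee_fin.
by rewrite lee_fin; have := S_ge0 x; nra.
Qed.

Lemma growth_le t : (0 <= t <= 1)%R -> growth t <= \int[P]_x (S x)%:E.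
Proof.
move=> t01; apply: ae_le_integral.
- exact: measurable_lne_wealth.
- exact: measurable_int intS.
- by apply: aeW => x; exact: lne_wealth_le.
Qed.

Lemma integrable_lne_wealth t : (0 <= t <= 1)%R -> -oo < growth t ->
  P.-integrable setT (fun x => lne (wealth t x)%:E).
Proof.
move=> t01 tNy; apply: (ae_le_integrable _ intS) => //.
  exact: measurable_lne_wealth.
by apply: aeW => x; exact: lne_wealth_le.
Qed.

Lemma wealth_gt0 t : (0 <= t <= 1)%R -> -oo < growth t ->
  {ae P, forall x, (0 < wealth t x)%R}.
Proof.
move=> t01 tNy.
have := integrable_ae measurableT (integrable_lne_wealth t01 tNy).
by apply: filterS => x /(_ Logic.I)/=; rewrite ltNge; case: ifPn.
Qed.

(** A maximising sequence has a convergent subsequence by Bolzano-Weierstrass,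
    and Fatou's lemma for the nonnegative functions S - log W shows that the
    growth rate at the limit is at least the limit of the growth rates.
    Boundary optima are included: at t = 1 the logarithm may take the value
    -oo. *)
Lemma exists_log_optimal : exists2 t : R, (0 <= t <= 1)%R &
  forall t' : R, (0 <= t' <= 1)%R -> growth t' <= growth t.
Proof.
have intSfin : \int[P]_x (S x)%:E \is a fin_num by exact: integrable_fin_num.
pose I := [set t : R | (0 <= t <= 1)%R].
pose M := ereal_sup (growth @` I).
have M_ge t : I t -> growth t <= M.
  by move=> It; apply: ereal_sup_ubound; exists t.
have I0 : I 0%R by rewrite /I/= lexx ler01.
have M0 : 0 <= M by rewrite -growth0; exact: M_ge.
have MS : M <= \int[P]_x (S x)%:E.
  by apply: ge_ereal_sup => _ [t It <-]; exact: growth_le.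
have Mfin : M \is a fin_num.
  by rewrite ge0_fin_numE// (le_lt_trans MS)// ltey_eq intSfin.
have /choice[u Iu] : forall n : nat,
    exists t, I t /\ M - (n.+1%:R^-1)%:E < growth t.
  move=> n; have /ereal_sup_gt[_ [t It <-] lt] : M - (n.+1%:R^-1)%:E < M.
    by rewrite lteBlDr// lteDl// lte_fin invr_gt0.
  by exists t.
have [f fincr /cvg_ex[/= t uft]] : exists2 f : nat -> nat, increasing_seq f &
    cvgn (u \o f).
  apply: bolzano_weierstrass; exists 1%R; split; first exact: num_real.
  move=> x x1 n _; have [/= /andP[u0 u1] _] := Iu n.
  by rewrite ger0_norm// (le_trans u1)// ltW.
have f_ge n : (n <= f n)%N.
  elim: n => // n ih; rewrite (leq_ltn_trans ih)//.
  by move/increasing_seqP : fincr => /(_ n).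
have t01 : (0 <= t <= 1)%R.
  apply/andP; split.
    by apply: (cvgr_to_ge uft); apply: nearW => n;
      have [/= /andP[]] := Iu (f n).
  by apply: (cvgr_to_le uft); apply: nearW => n; have [/= /andP[]] := Iu (f n).
exists t => // t' It'; apply: le_trans (M_ge _ It') _.
(* Subtracting from S turns the upper bound [lne_wealth_le] into the
   nonnegativity that Fatou's lemma asks for. *)
pose F n x := (S x)%:E - lne (wealth (u (f n)) x)%:E.
have F_ge0 n x : 0 <= F n x.
  have [It _] := Iu (f n).
  rewrite /F sube_ge0; last by rewrite orbT.
  exact: lne_wealth_le.
have mF n : measurable_fun setT (F n).
  apply: emeasurable_funB; first exact: measurable_int intS.
  exact: measurable_lne_wealth.
have F_cvg x : F n x @[n --> \oo] --> (S x)%:E - lne (wealth t x)%:E.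
  apply: cvgeB => //; first exact: cvg_cst.
  apply: cvg_lne; apply: cvgD; first by apply: cvgB => //; exact: cvg_cst.
  by apply: cvgMl.
have intF n : \int[P]_x F n x <= \int[P]_x (S x)%:E - (M - (n.+1%:R^-1)%:E).
  have [It lt] := Iu (f n).
  have tNy : -oo < growth (u (f n)) by apply: le_lt_trans lt; rewrite leNye.
  rewrite integralB//; last exact: integrable_lne_wealth.
  apply: leeB => //; apply: (le_trans _ (ltW lt)); apply: leeB => //.
  by rewrite lee_fin lef_pV2 ?posrE// ler_nat ltnS.
have FM : \int[P]_x ((S x)%:E - lne (wealth t x)%:E) <= \int[P]_x (S x)%:E - M.
  have -> : \int[P]_x ((S x)%:E - lne (wealth t x)%:E) =
      \int[P]_x limn_einf (F ^~ x).
    by apply: eq_integral => x _; rewrite (cvg_limn_einf_sup (F_cvg x)).1.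
  apply: le_trans (fatou _ _ mF _) _ => //.
  have cM : \int[P]_x (S x)%:E - (M - (n.+1%:R^-1)%:E) @[n --> \oo] -->
      \int[P]_x (S x)%:E - (M - 0).
    have Mc : M - (n.+1%:R^-1)%:E @[n --> \oo] --> M - 0.
      apply: cvgeB; [by rewrite fin_num_adde_defl|exact: cvg_cst|].
      by apply: (@cvg_EFin R nat \oo); [exact: nearW|exact: cvg_harmonic].
    apply: cvgeB; [by rewrite fin_num_adde_defr|exact: cvg_cst|exact: Mc].
  rewrite sube0 in cM; rewrite -(cvg_limn_einf_sup cM).1.
  rewrite !limn_einf_lim; apply: lee_lim; [exact: is_cvg_einfs..|].
  apply: nearW => n; apply: le_ereal_inf_tmp => _ [k nk <-].
  by apply: le_trans (intF k); apply: ereal_inf_lbound; exists k.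
have SW_ge0 x : 0 <= (S x)%:E - lne (wealth t x)%:E.
  by rewrite sube_ge0 ?orbT//; exact: lne_wealth_le.
have intSW : P.-integrable setT (fun x => (S x)%:E - lne (wealth t x)%:E).
  apply/integrableP; split.
    apply: emeasurable_funB; first exact: measurable_int intS.
    exact: measurable_lne_wealth.
  under eq_integral do rewrite gee0_abs//.
  by rewrite (le_lt_trans FM)// ltey_eq fin_numB intSfin Mfin.
(* Recover log W as S - (S - log W), both terms of which are integrable. *)
rewrite /growth (eq_integral (fun x =>
  (S x)%:E - ((S x)%:E - lne (wealth t x)%:E))); last first.
  by move=> x _; case: (lne _) => [r| |] //=; rewrite -!EFinB subKr.
rewrite integralB// leeBrDr; last exact: integrable_fin_num.
by rewrite addeC -leeBrDr// (le_trans FM).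
Qed.

End log_optimal.

(** * Log-optimal investment: first-order condition *)

Section log_optimal_ratio.
Context d (T : measurableType d) (R : realType) (P : probability T R).
Variable S : T -> R.
Hypothesis S_ge0 : forall x, (0 <= S x)%R.
Hypothesis intS : P.-integrable setT (EFin \o S).
Variable t : R.
Hypothesis t01 : (0 <= t <= 1)%R.
Hypothesis t_opt : forall s : R, (0 <= s <= 1)%R ->
  growth P S s <= growth P S t.

Lemma log_optimal_growth_ge0 : 0 <= growth P S t.
Proof. by rewrite -(growth0 P S) t_opt// lexx ler01. Qed.

Let tNy : -oo < growth P S t.
Proof. exact: lt_le_trans (ltNyr 0) log_optimal_growth_ge0. Qed.

Let intlw : P.-integrable setT (fun x => lne (wealth S t x)%:E).
Proof. exact: integrable_lne_wealth. Qed.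

Let mw s : measurable_fun setT (wealth S s).
Proof. exact: measurable_wealth intS s. Qed.

(** The Kuhn-Tucker condition of log-optimal investment.  Put
    y = W_t' / W_t.  Replacing t by s = (1 - e) t + e t' multiplies the wealth
    by D = 1 + e (y - 1), and log D >= 1 - 1 / D, so optimality of t yields
    E[1 - 1 / D] <= 0, that is E[(y - 1) / D] <= 0.  As e tends to 0 the
    integrand tends to y - 1; as it is bounded below by -2 when e <= 1 / 2,
    Fatou's lemma gives E[y - 1] <= 0. *)
Lemma log_optimal_expected_ratio (t' : R) : (0 <= t' <= 1)%R ->
  \int[P]_x (wealth S t' x / wealth S t x)%:E <= 1.
Proof.
move=> t'01; pose y x := (wealth S t' x / wealth S t x)%R.
have y0 x : (0 <= y x)%R by rewrite divr_ge0//; exact: wealth_ge0.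
have my : measurable_fun setT y.
  apply: measurable_funM => //; apply: measurable_inv_ge0 => // x.
  exact: wealth_ge0.
(* The index is shifted by 2 to have e <= 1 / 2. *)
pose e n : R := (n.+2%:R^-1)%R.
have e0 n : (0 < e n)%R by rewrite invr_gt0.
have e1 n : (e n <= 2^-1)%R by rewrite lef_pV2 ?posrE// ler_nat.
pose D n x : R := (1 + e n * (y x - 1))%R.
have D0 n x : (2^-1 <= D n x)%R.
  by rewrite /D; have := y0 x; have := e0 n; have := e1 n; nra.
have Dgt0 n x : (0 < D n x)%R by rewrite (lt_le_trans _ (D0 n x)).
have mD n : measurable_fun setT (D n).
  by apply: measurable_funD => //; apply: measurable_funM => //;
    exact: measurable_funB.
have mDV n : measurable_fun setT (fun x => (D n x)^-1%R).
  by apply: measurable_inv_ge0 => // x; exact: ltW.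
have bDV n x : (0 <= (D n x)^-1 <= 2)%R.
  by rewrite invr_ge0 ltW//= invf_ple ?posrE.
have intDV n : P.-integrable setT (fun x => (1 - (D n x)^-1)%:E).
  apply: measurable_bounded_integrable => //.
  - by rewrite ltey_eq fin_num_measure.
  - exact: measurable_funB.
  - exists 3%R; split; first exact: num_real.
    move=> M M3 x _ /=; rewrite (le_trans _ (ltW M3))// ler_norml.
    by have /andP[] := bDV n x; lra.
have DV_le0 n : \int[P]_x (1 - (D n x)^-1)%:E <= 0.
  pose s := ((1 - e n) * t + e n * t')%R.
  have s01 : (0 <= s <= 1)%R.
    by rewrite /s; have := e0 n; have := e1 n;
      move: t01 t'01 => /andP[? ?] /andP[? ?] ? ?; apply/andP; split; nra.
  have le_s : growth P S t + \int[P]_x (1 - (D n x)^-1)%:E <= growth P S s.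
    rewrite -integralD//.
    apply: ae_le_integral.
    - apply: emeasurable_funD; first exact: measurable_lne_wealth intS _.
      exact: measurable_int (intDV n).
    - exact: measurable_lne_wealth intS _.
    - apply: filterS (wealth_gt0 S_ge0 intS t01 tNy) => x wt0.
      have -> : wealth S s x = (wealth S t x * D n x)%R.
        rewrite /D mulrDr mulr1 mulrCA mulrBr /y mulrCA divff ?gt_eqF// !mulr1.
        by rewrite /s /wealth; ring.
      rewrite !lne_EFin// ?mulr_gt0// -EFinD lee_fin lnM ?posrE//.
      rewrite lerD2l -lerN2 opprB -lnV ?posrE//.
      have := @le_ln1Dx R ((D n x)^-1 - 1)%R.
      by rewrite [(1 + _)%R]addrC subrK; apply; rewrite ltrBrDl subrr invr_gt0.
  have gfin : growth P S t \is a fin_num.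
    exact: integrable_fin_num.
  have := le_trans le_s (t_opt s01).
  by rewrite -leeBrDl// subee.
(* The integrand (y - 1) / D shifted by 2, which makes it nonnegative; this form
   exhibits it as a multiple of the bounded function 1 - 1 / D. *)
pose h n x : R := ((e n)^-1 * (1 - (D n x)^-1) + 2)%R.
have hE n x : h n x = ((y x - 1) / D n x + 2)%R.
  have := lt0r_neq0 (Dgt0 n x); have := lt0r_neq0 (e0 n).
  by rewrite /h /D => en0 Dn0; field; apply/andP.
have h0 n x : (0 <= h n x)%R.
  have -> : h n x = ((y x - 1 + 2 * D n x) / D n x)%R.
    by rewrite hE; field; exact: lt0r_neq0.
  apply: divr_ge0; last exact: ltW.
  rewrite /D.
  have := mulr_ge0 (ltW (e0 n)) (y0 x); have := y0 x; have := e1 n.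
  by move: (e n) (y x) => a b; nra.
have ih n : \int[P]_x (h n x)%:E <= 2%:E.
  under eq_integral do rewrite EFinD EFinM.
  rewrite integralD//=; last 2 first.
    exact: integrableZl.
    exact: finite_measure_integrable_cst.
  rewrite integralZl// integral_cst//= probability_setT mule1.
  rewrite -[leRHS]add0e leeD2r//.
  by rewrite mule_ge0_le0// lee_fin invr_ge0 ltW.
have cvgh x : (h n x)%:E @[n --> \oo] --> (y x + 1)%:E.
  apply: cvg_EFin; first exact: nearW.
  rewrite (_ : fine \o _ = (fun n => (y x - 1) / D n x + 2)%R); last first.
    by apply/funext => n /=; rewrite hE.
  have -> : (y x + 1 = (y x - 1) / 1 + 2)%R by field.
  apply: cvgD; last exact: cvg_cst.
  apply: cvgMl_tmp; apply: cvgV => //.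
  have -> : (1 = 1 + 0 * (y x - 1) :> R)%R by ring.
  apply: cvgD; first exact: cvg_cst.
  apply: cvgMr_tmp.
  have := @cvg_harmonic R; rewrite -cvg_shiftS; exact.
have : \int[P]_x (y x + 1)%:E <= 2%:E.
  under eq_integral => x _ do rewrite -(cvg_limn_einf_sup (cvgh x)).1.
  apply: le_trans (fatou _ _ _ _) _ => //.
  - move=> n; apply/measurable_EFinP; apply: measurable_funD => //.
    by apply: measurable_funM => //; exact: measurable_funB.
  - by move=> n x _; rewrite lee_fin.
  - rewrite limn_einf_lim; apply: lime_le; first exact: is_cvg_einfs.
    apply: nearW => n; apply: le_trans (ih n).
    by apply: ereal_inf_lbound; exists n => /=.
under eq_integral do rewrite EFinD.
rewrite ge0_integralD//=; last 2 first.
- by move=> x _; rewrite lee_fin.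
- exact/measurable_EFinP.
rewrite integral_cst//= probability_setT mule1 -leeBrDr//.
by rewrite -EFinB addrK.
Qed.

End log_optimal_ratio.

(** * Measures given by a density *)

Section density_measure.
Context d (T : measurableType d) (R : realType).
Variables (mu : {measure set T -> \bar R}) (g : T -> R).

(** The proofs are arguments so that the measure structures below can be
    inferred from the term alone. *)
Definition density_measure of mu.-integrable setT (EFin \o g)
    & (forall x, 0 <= g x)%R : set T -> \bar R :=
  fun A => \int[mu]_(x in A) (g x)%:E.

Hypothesis intg : mu.-integrable setT (EFin \o g).
Hypothesis g_ge0 : forall x, (0 <= g x)%R.
Local Notation nu := (density_measure intg g_ge0).

Let nu0 : nu set0 = 0. Proof. by rewrite /nu integral_set0. Qed.

Let nu_ge0 A : 0 <= nu A.
Proof. by apply: integral_ge0 => x _; rewrite lee_fin. Qed.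

Let nu_sigma_additive : semi_sigma_additive nu.
Proof.
apply: semi_sigma_additive_nng_induced; first exact: measurable_int intg.
by move=> x; rewrite lee_fin.
Qed.

HB.instance Definition _ :=
  isMeasure.Build _ _ _ nu nu0 nu_ge0 nu_sigma_additive.

Let nu_fin : fin_num_fun nu.
Proof.
by move=> A mA; apply: integrable_fin_num => //; exact: integrableS intg.
Qed.

HB.instance Definition _ := Measure_isFinite.Build _ _ _ nu nu_fin.

End density_measure.

Section density_integral.
Context d (T : measurableType d) (R : realType).
Variables (P : probability T R) (g : T -> R).
Hypothesis intg : P.-integrable setT (EFin \o g).
Hypothesis g_ge0 : forall x, (0 <= g x)%R.
Local Notation nu := (density_measure intg g_ge0).

(** [g] is a Radon-Nikodym derivative of [nu], so the change of variables for
    Radon-Nikodym derivatives applies. *)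
Lemma integral_density (f : T -> \bar R) A : measurable A ->
  measurable_fun A f -> (forall x, 0 <= f x) ->
  \int[nu]_(x in A) f x = \int[P]_(x in A) (f x * (g x)%:E).
Proof.
move=> mA mf f0; have mg := measurable_int _ intg.
have nuP : nu `<< P.
  apply/null_content_dominatesP => B mB PB0.
  by apply: null_set_integral => //; exact: measurable_funTS.
have intRN := Radon_Nikodym_SigmaFinite.f_integrable nuP.
rewrite -(Radon_Nikodym_SigmaFinite.change_of_variables nuP)//.
apply: ae_eq_integral => //.
- apply: emeasurable_funM => //; apply: measurable_funTS.
  exact: measurable_int intRN.
- by apply: emeasurable_funM => //; exact: measurable_funTS.
- apply: ae_eqe_mul2l; apply: ae_eq_subset (@subsetT _ A) _.
  apply: integral_ae_eq => // B _ mB.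
  by rewrite -Radon_Nikodym_SigmaFinite.f_integral.
Qed.

Variable z : T.
Hypothesis g_le1 : \int[P]_x (g x)%:E <= 1.

Let c : R := fine (1 - \int[P]_x (g x)%:E).

Let c_ge0 : (0 <= c)%R.
Proof. by rewrite fine_ge0// sube_ge0 ?orbT. Qed.

(** The mass missing from a subprobability density is put at the point [z]. *)
Lemma exists_completed_density : exists Q : probability T R,
  forall (f : T -> \bar R) A, measurable A -> measurable_fun A f ->
  (forall x, 0 <= f x) ->
  \int[Q]_(x in A) f x =
  \int[P]_(x in A) (f x * (g x)%:E) + c%:E * (\d_z A * f z).
Proof.
(* The sum has mass 1, so normalising leaves it unchanged and only serves to
   equip it with the structure of a probability. *)
pose m : {measure set T -> \bar R} :=
  measure_add nu (mscale (NngNum c_ge0) \d_z).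
exists (mnormalize m P) => f A mA mf f0.
have m1 : m setT = 1.
  have -> : m setT = nu setT + c%:E * \d_z setT.
    exact: measure_addE.
  rewrite diracT mule1 /density_measure.
  rewrite /c fineK; last by rewrite fin_numB// integrable_fin_num.
  by rewrite addeC subeK// integrable_fin_num.
rewrite (@eq_measure_integral _ _ _ A m); last first.
  move=> B mB _; rewrite -[LHS]/(mnormalize m P B) /mnormalize m1 onee_eq0/=.
  by rewrite invr1 mule1.
rewrite ge0_integral_measure_add// integral_density//.
by rewrite ge0_integral_mscale//= integral_dirac.
Qed.

End density_integral.

(** * Bounds on the Kullback-Leibler divergence *)

Section KL_bounds.
Context (R : realType).
Implicit Types (F G : probability R R) (w : R -> R).

(** Passes to the version of dF/dG that is nonnegative everywhere. *)
Lemma KL_RadonNikodymE F G : F `<< G ->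
  KL F G = \int[F]_x lne (Radon_Nikodym_SigmaFinite.f F G x).
Proof.
move=> FG; rewrite /KL asboolT//; apply: ae_eq_integral => //.
- apply: measurableT_comp; first exact: measurable_lne.
  by apply: measurable_int; exact: Radon_Nikodym_integrable.
- apply: measurableT_comp; first exact: measurable_lne.
  by apply: measurable_int; exact: Radon_Nikodym_SigmaFinite.f_integrable.
- have /null_dominates_ae_eq : ae_eq G setT
      (Radon_Nikodym_SigmaFinite.f F G)
      (Radon_Nikodym (charge_of_finite_measure F) G).
    exact: ae_eq_Radon_Nikodym_SigmaFinite.
  move=> /(_ F measurableT FG); apply: filterS => x /(_ Logic.I) fx _.
  by rewrite fx.
Qed.

(** Integrate log w <= log p + w / p - 1 against F, where p = dF/dG is
    positive F-almost everywhere: the integral of w / p against F is at most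
    that of w against G.  This is weak duality, w being a feasible bet
    against G. *)
Lemma expected_lne_le_KL F G w : measurable_fun setT w ->
  (forall x, 0 <= w x)%R -> F.-integrable setT (EFin \o w) ->
  \int[G]_x (w x)%:E <= 1 -> \int[F]_x lne (w x)%:E <= KL F G.
Proof.
move=> mw w0 intw Gw.
have [FG|nFG] := pselect (F `<< G); last by rewrite /KL asboolF// leey.
rewrite KL_RadonNikodymE//.
have [->|Ny] := eqVneq (\int[F]_x lne (w x)%:E) -oo; first by rewrite leNye.
have mlw : measurable_fun setT (fun x => lne (w x)%:E).
  by apply: measurableT_comp; [exact: measurable_lne|exact/measurable_EFinP].
have intlw : F.-integrable setT (fun x => lne (w x)%:E).
  apply: (ae_le_integrable mlw intw); last by rewrite ltNye.
  by apply: aeW => x; exact/ltW/lne_sublinear.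
pose f := Radon_Nikodym_SigmaFinite.f F G; pose p x := fine (f x).
have fE x : f x = (p x)%:E.
  by rewrite /p fineK//; exact: Radon_Nikodym_SigmaFinite.f_fin_num.
have p0 x : (0 <= p x)%R.
  by rewrite -lee_fin -fE; exact: Radon_Nikodym_SigmaFinite.f_ge0.
have mf : measurable_fun setT f.
  exact: measurable_int (Radon_Nikodym_SigmaFinite.f_integrable FG).
have mp : measurable_fun setT p.
  by apply/measurable_EFinP; apply: eq_measurable_fun mf => x _; rewrite /= fE.
have p_gt0 : {ae F, forall x, (0 < p x)%R}.
  have mZ : measurable [set x | f x <= 0].
    by rewrite -[X in measurable X]setTI; apply: measurable_lee.
  exists [set x | f x <= 0]; split => //.
  - rewrite [LHS](Radon_Nikodym_SigmaFinite.f_integral FG)//.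
    apply: integral0_eq => x fx0; apply/eqP; rewrite eq_le; apply/andP.
    by split => //; exact: Radon_Nikodym_SigmaFinite.f_ge0.
  - by move=> x /= /negP; rewrite -leNgt fE lee_fin.
pose r x := (w x / p x)%R.
have r0 x : (0 <= r x)%R by rewrite divr_ge0.
have mr : measurable_fun setT r.
  by apply: measurable_funM => //; exact: measurable_inv_ge0.
have rle1 : \int[F]_x (r x)%:E <= 1.
  have <- : \int[G]_x ((r x)%:E * f x) = \int[F]_x (r x)%:E.
    apply: Radon_Nikodym_SigmaFinite.change_of_variables => //.
    exact/measurable_EFinP.
  apply: le_trans Gw; apply: ge0_le_integral => //.
  - by move=> x _; rewrite fE -EFinM lee_fin mulr_ge0.
  - by apply: emeasurable_funM => //; exact/measurable_EFinP.
  - exact/measurable_EFinP.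
  - move=> x _; rewrite fE -EFinM lee_fin /r.
    have [->|pn0] := eqVneq (p x) 0%R; first by rewrite mulr0.
    by rewrite divfK.
have intr : F.-integrable setT (EFin \o r).
  apply/integrableP; split; first exact/measurable_EFinP.
  under eq_integral do rewrite gee0_abs ?lee_fin//.
  exact: le_lt_trans rle1 (ltry _).
have intr1 : F.-integrable setT (fun x => (1 - r x)%:E).
  have int1 : F.-integrable setT (EFin \o cst (1 : R)%R).
    exact: finite_measure_integrable_cst.
  exact: (integrableB measurableT int1 intr).
apply: (@le_trans _ _ (\int[F]_x (lne (w x)%:E + (1 - r x)%:E))).
  rewrite integralD// leeDl//.
  rewrite (_ : \int[F]_x _ = \int[F]_x (1 - (r x)%:E)); last by [].
  rewrite integralB//; last exact: finite_measure_integrable_cst.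
  rewrite integral_cst//= probability_setT mule1.
  by rewrite sube_ge0 ?orbT.
apply: ae_le_integral.
- by apply: emeasurable_funD => //; exact: measurable_int intr1.
- by apply: measurableT_comp => //; exact: measurable_lne.
- apply: filterS p_gt0 => x px; rewrite -/f fE.
  have [wx0|wx0] := leP (w x) 0%R; first by rewrite le0_lneNy// leNye.
  rewrite !lne_EFin// -EFinD lee_fin.
  have : (ln (1 + (r x - 1)) <= r x - 1)%R.
    by rewrite le_ln1Dx// ltrBrDl subrr divr_gt0.
  by rewrite [(1 + _)%R]addrC subrK /r ln_div ?posrE//; lra.
Qed.

(** The hypothesis says that F is bounded by the measure of density [w] with
    respect to G, so dF/dG <= [w] almost everywhere; comparing the densities
    avoids computing dF/dG. *)
Lemma KL_le_expected_lne F G w : measurable_fun setT w ->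
  (forall x, 0 <= w x)%R ->
  (forall A, measurable A -> F A <= \int[G]_(x in A) (w x)%:E) ->
  KL F G <= \int[F]_x lne (w x)%:E.
Proof.
move=> mw w0 Fw.
have mwE A : measurable_fun A (fun x => (w x)%:E).
  by apply: measurable_funTS; exact/measurable_EFinP.
have FG : F `<< G.
  apply/null_content_dominatesP => A mA GA0; apply/eqP.
  by rewrite eq_le measure_ge0 andbT (le_trans (Fw _ mA))// null_set_integral.
rewrite KL_RadonNikodymE//.
set f := Radon_Nikodym_SigmaFinite.f F G.
have intf : G.-integrable setT f.
  exact: Radon_Nikodym_SigmaFinite.f_integrable.
have mf := measurable_int _ intf.
have f0 x : 0 <= f x by exact: Radon_Nikodym_SigmaFinite.f_ge0.
pose A := [set x | (w x)%:E < f x].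
have mA : measurable A.
  by rewrite -[A]setTI; apply: measurable_lte => //; exact/measurable_EFinP.
have GA : G A = 0.
  have intfA : G.-integrable A f by exact: integrableS intf.
  have [N [mN GN0 AN]] : ae_eq G A f (fun x => (w x)%:E).
    apply: integral_ae_eq => // E EA mE; apply/eqP; rewrite eq_le.
    apply/andP; split.
      by rewrite -Radon_Nikodym_SigmaFinite.f_integral//; exact: Fw.
    apply: ge0_le_integral => //.
    - by move=> x _; rewrite lee_fin.
    - exact: measurable_funTS.
    - by move=> x /EA/ltW.
  apply: (subset_measure0 mA mN) => // x Ax; apply: AN => /= /(_ Ax) fw.
  by move: Ax; rewrite /A/= fw ltxx.
have FA : F A = 0 by move/null_content_dominatesP : FG; exact.
apply: ae_le_integral.
- by apply: measurableT_comp => //; exact: measurable_lne.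
- by apply: measurableT_comp => //; exact: measurable_lne.
- exists A; split => // x; apply: contra_notP => /negP.
  rewrite -leNgt => fwx; change (lne (f x) <= lne (w x)%:E).
  by rewrite lee_lne// in_itv/= leey andbT ?lee_fin.
Qed.

End KL_bounds.

(** * Distributions on a half-line and their means *)

Section bounded_above.
Context (R : realType).
Implicit Types (Q : probability R R) (a : \bar R) (mu x : R).

Lemma measurable_support a : measurable [set x : R | a <= x%:E <= 1].
Proof.
have -> : [set x : R | a <= x%:E <= 1] = EFin @^-1` `[a, 1].
  by apply/seteqP; split => x /=; rewrite in_itv.
rewrite -[X in measurable X]setTI; apply: EFin_measurable => //.
exact: emeasurable_itv.
Qed.

Lemma prob_on_setC a Q :
  prob_on a Q <-> Q (~` [set x : R | a <= x%:E <= 1]) = 0.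
Proof.
have mA := measurable_support a; rewrite /prob_on/=; split => QA.
  by rewrite probability_setC// QA subee.
by rewrite -[X in Q X]setCK probability_setC ?QA ?sube0//; exact: measurableC.
Qed.

Lemma prob_on_le1 a Q : prob_on a Q -> {ae Q, forall x, (x <= 1)%R}.
Proof.
move=> /prob_on_setC QA; exists (~` [set x : R | a <= x%:E <= 1]); split => //.
  by apply: measurableC; exact: measurable_support.
by move=> x /= x1 /andP[_]; rewrite lee_fin.
Qed.

Lemma prob_on_ninfty a Q : prob_on a Q -> prob_on -oo Q.
Proof.
move=> Qa; apply/eqP; rewrite eq_le probability_le1/=; last first.
  exact: measurable_support.
rewrite -[leLHS]Qa; apply: le_measure.
- by rewrite inE; exact: measurable_support.
- by rewrite inE; exact: measurable_support.
- by move=> x /= /andP[_ ->]; rewrite leNye.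
Qed.

(** Truncated at 0 so as to be nonnegative on the whole line; the truncation is
    invisible to distributions on (-oo, 1]. *)
Definition payoff mu x : R := Num.max 0%R ((1 - x) / (1 - mu))%R.

Variables (mu : R).
Hypothesis mu1 : (mu < 1)%R.

Lemma payoff_ge0 x : (0 <= payoff mu x)%R.
Proof. by rewrite /payoff le_max lexx. Qed.

Lemma payoffE x : (x <= 1)%R -> payoff mu x = ((1 - x) / (1 - mu))%R.
Proof.
by move=> x1; apply/max_idPr; rewrite divr_ge0// subr_ge0// ltW.
Qed.

Lemma measurable_payoff : measurable_fun setT (payoff mu).
Proof.
apply: measurable_maxr; first exact: measurable_cst.
by apply: measurable_funM => //; exact: measurable_funB.
Qed.

(** On (-oo, 1] one has x = 1 - (1 - mu) S(x). *)
Lemma mean_payoff Q : {ae Q, forall x, (x <= 1)%R} ->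
  Q.-integrable setT (EFin \o payoff mu) ->
  mean Q = 1 - (1 - mu)%:E * \int[Q]_x (payoff mu x)%:E.
Proof.
move=> Q1 intS; rewrite /mean unlock.
have intS' : Q.-integrable setT (fun x => (1 - mu)%:E * (payoff mu x)%:E).
  exact: integrableZl.
rewrite (ae_eq_integral (fun x => 1 - (1 - mu)%:E * (payoff mu x)%:E))//.
- rewrite integralB//; last exact: finite_measure_integrable_cst.
  by rewrite integralZl// integral_cst//= probability_setT mule1.
- exact: EFin_measurable.
- by apply: emeasurable_funB => //; exact: measurable_int intS'.
- apply: filterS Q1 => x x1 _; rewrite payoffE// -EFinM -EFinB; congr (_%:E).
  by rewrite /=; field; rewrite subr_eq0 gt_eqF.
Qed.

(** A mean above [mu] is not -oo, and the variable is bounded above, so it is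
    integrable and [mean_payoff] applies. *)
Lemma mean_gt_payoff_le1 Q : {ae Q, forall x, (x <= 1)%R} -> mu%:E < mean Q ->
  \int[Q]_x (payoff mu x)%:E <= 1.
Proof.
move=> Q1 Qmu.
have int1 : Q.-integrable setT (EFin \o cst (1 : R)%R).
  exact: finite_measure_integrable_cst.
have intid : Q.-integrable setT (EFin \o (idfun : R -> R)).
  apply: (ae_le_integrable _ int1).
  - exact: EFin_measurable.
  - by apply: filterS Q1 => x x1; rewrite /= lee_fin.
  - by move: Qmu; rewrite /mean unlock; apply: lt_trans; rewrite ltNyr.
have intS : Q.-integrable setT (EFin \o payoff mu).
  have : Q.-integrable setT (fun x => (1 - mu)^-1%:E * (1%:E - x%:E)).
    exact: (integrableZl measurableT _ (integrableB measurableT int1 intid)).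
  apply: le_integrable => //.
    by apply/measurable_EFinP; exact: measurable_payoff.
  move=> x _; rewrite /= lee_fin ger0_norm ?payoff_ge0// mulrC.
  by rewrite /payoff ge_max normr_ge0 ler_norm.
have Sfin : \int[Q]_x (payoff mu x)%:E \is a fin_num.
  exact: integrable_fin_num.
move: Qmu; rewrite mean_payoff// -(fineK Sfin) -EFinM -EFinB !lte_fin lee_fin.
move: (fine _) => s mus; rewrite leNgt; apply/negP => s1.
have : (0 < (1 - mu) * (s - 1))%R by rewrite mulr_gt0// subr_gt0.
by lra.
Qed.

Lemma payoff_lt1_mean Q : {ae Q, forall x, (x <= 1)%R} ->
  \int[Q]_x (payoff mu x)%:E < 1 -> mu%:E < mean Q.
Proof.
move=> Q1 QS.
have intS : Q.-integrable setT (EFin \o payoff mu).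
  apply/integrableP; split.
    by apply/measurable_EFinP; exact: measurable_payoff.
  under eq_integral do rewrite gee0_abs ?lee_fin ?payoff_ge0//.
  exact: lt_trans QS (ltry _).
have Sfin : \int[Q]_x (payoff mu x)%:E \is a fin_num.
  exact: integrable_fin_num.
move: QS; rewrite mean_payoff// -(fineK Sfin) -EFinM -EFinB !lte_fin.
move: (fine _) => s s1.
have : (0 < (1 - mu) * (1 - s))%R by rewrite mulr_gt0// subr_gt0.
by lra.
Qed.

(** The payoff grows linearly at -oo, hence is dominated by exp(- s x) for any
    s > 0 at which the moment generating function is finite at - s. *)
Lemma integrable_payoff Q :
  (\forall t \near (0%R : R), 'M_Q (idfun : R -> R) t < +oo) ->
  Q.-integrable setT (EFin \o payoff mu).
Proof.
move=> [e /= e0 Qe]; pose s := (e / 2)%R.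
have s0 : (0 < s)%R by rewrite divr_gt0.
have : 'M_Q (idfun : R -> R) (- s) < +oo.
  apply: Qe; rewrite /ball/= sub0r opprK gtr0_norm// /s.
  by rewrite ltr_pdivrMr// ltr_pMr// ltr1n.
rewrite /mmt_gen_fun unlock => mgf.
have intexp : Q.-integrable setT (fun x => (expR (- s * x))%:E).
  apply/integrableP; split.
    by apply/measurable_EFinP; apply: measurableT_comp.
  by under eq_integral do rewrite gee0_abs ?lee_fin ?expR_ge0// mulrC.
have intb : Q.-integrable setT
    (fun x => (1 - mu)^-1%:E * (1%:E + s^-1%:E * (expR (- s * x))%:E)).
  apply: integrableZl => //; apply: integrableD => //.
    exact: finite_measure_integrable_cst.
  exact: integrableZl.
apply: le_integrable intb => //.
  by apply/measurable_EFinP; exact: measurable_payoff.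
move=> x _; rewrite /= lee_fin ger0_norm ?payoff_ge0//.
have E0 : (0 <= s^-1 * expR (- s * x))%R.
  by rewrite mulr_ge0 ?expR_ge0// invr_ge0 ltW.
have m0 : (0 <= (1 - mu)^-1)%R by rewrite invr_ge0 subr_ge0 ltW.
rewrite ger0_norm; last by rewrite mulr_ge0// addr_ge0.
rewrite /payoff ge_max mulr_ge0//= ?addr_ge0// mulrC ler_wpM2l// lerD2l.
rewrite -[(- x)%R](@mulKf _ s) ?gt_eqF// ler_wpM2l ?invr_ge0 ?(ltW s0)//.
by rewrite mulrN -mulNr (le_trans _ (expR_ge1Dx _))// lerDr.
Qed.

End bounded_above.

(** * Duality for means above a level below 1 *)

Section duality.
Context (R : realType) (F : probability R R) (mu : R).
Hypothesis mu1 : (mu < 1)%R.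
Hypothesis F1 : {ae F, forall x, (x <= 1)%R}.
Let S := payoff mu.
Hypothesis intS : F.-integrable setT (EFin \o S).

Let S_ge0 x : (0 <= S x)%R. Proof. exact: payoff_ge0. Qed.

(** The change of variable t = nu (1 - mu) maps [0, 1 / (1 - mu)] onto
    [0, 1]. *)
Lemma expected_logE nu : expected_log F mu nu = growth F S (nu * (1 - mu))%R.
Proof.
apply: ae_eq_integral => //.
- apply: (measurableT_comp (@measurable_lne R setT)) => //.
  apply/measurable_EFinP; apply: measurable_funB => //.
  by apply: measurable_funM => //; exact: measurable_funB.
- exact: measurable_lne_wealth intS _.
- apply: filterS F1 => x x1 _; congr (lne _%:E).
  rewrite /wealth /S payoffE//; field.
  by rewrite subr_eq0 gt_eqF.
Qed.

Lemma log_optimal_Lmax (t : R) : (0 <= t <= 1)%R ->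
  (forall s : R, (0 <= s <= 1)%R -> growth F S s <= growth F S t) ->
  Lvalues F mu (growth F S t) /\ Lmax F mu = growth F S t.
Proof.
have m0 : (0 < 1 - mu)%R by rewrite subr_gt0.
move=> /andP[t0 t1] t_opt.
have tL : Lvalues F mu (growth F S t).
  exists (t / (1 - mu))%R; last by rewrite expected_logE divfK// gt_eqF.
  by rewrite /= divr_ge0 ?(ltW m0)//= ler_pM2r// invr_gt0.
split => //; apply/eqP; rewrite eq_le ereal_sup_ubound// andbT.
apply: ge_ereal_sup => _ [nu /= /andP[nu0 nu1] <-]; rewrite expected_logE.
apply: t_opt; rewrite mulr_ge0 ?(ltW m0)//=.
by rewrite -ler_pdivlMr.
Qed.

Lemma growth_le_KL (G : probability R R) (t : R) : (0 <= t <= 1)%R ->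
  {ae G, forall x, (x <= 1)%R} -> mu%:E < mean G ->
  growth F S t <= KL F G.
Proof.
move=> t01 G1 Gmu; have /andP[t0 t1] := t01.
have mw : measurable_fun setT (wealth S t) by exact: measurable_wealth intS t.
apply: expected_lne_le_KL => //.
- by move=> x; exact: wealth_ge0.
- rewrite (_ : EFin \o _ = (fun x => (1 - t)%:E + t%:E * (S x)%:E))//.
  apply: integrableD => //; first exact: finite_measure_integrable_cst.
  exact: integrableZl.
- have GS := mean_gt_payoff_le1 mu1 G1 Gmu.
  have mS : measurable_fun setT S by exact: measurable_payoff.
  rewrite (eq_integral (fun x => (1 - t)%:E + t%:E * (S x)%:E))//.
  rewrite ge0_integralD//; last 3 first.
  + by move=> x _; rewrite lee_fin subr_ge0.
  + by move=> x _; rewrite mule_ge0// lee_fin.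
  + by apply: emeasurable_funM => //; exact/measurable_EFinP.
  rewrite integral_cst//= probability_setT mule1.
  rewrite ge0_integralZl//; last first.
  + by move=> x _; rewrite lee_fin.
  + exact/measurable_EFinP.
  apply: (@le_trans _ _ ((1 - t)%:E + t%:E * 1)).
    by apply: leeD => //; apply: lee_wpmul2l.
  by rewrite mule1 -EFinD subrK.
Qed.

(** The witness is q F / W_t completed by an atom at 1, where the payoff
    vanishes.  The optimality of [t], tested against s = 0 and s = 1, bounds its
    mass before completion and its expected payoff by [q]; and F is at most
    W_t / q times it. *)
Lemma exists_near_optimal (a : \bar R) (t q : R) : a < 1 -> prob_on a F ->
  (0 <= t <= 1)%R ->
  (forall s : R, (0 <= s <= 1)%R -> growth F S s <= growth F S t) ->
  (0 < q < 1)%R ->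
  exists G, [/\ prob_on a G, mu%:E < mean G &
    KL F G <= growth F S t - (ln q)%:E].
Proof.
move=> a1 Fa t01 t_opt /andP[q0 q1].
pose W := wealth S t.
have mW : measurable_fun setT W by exact: measurable_wealth intS t.
have mS : measurable_fun setT S by exact: measurable_payoff.
have W0 x : (0 <= W x)%R by exact: wealth_ge0.
have Wgt0 : {ae F, forall x, (0 < W x)%R}.
  apply: (wealth_gt0 S_ge0 intS t01); apply: lt_le_trans (ltNyr 0) _.
  exact: log_optimal_growth_ge0 t_opt.
have ratio := log_optimal_expected_ratio S_ge0 intS t01 t_opt.
pose g x : R := (q / W x)%R.
have g0 x : (0 <= g x)%R by rewrite divr_ge0// ltW.
have mg : measurable_fun setT g.
  by apply: measurable_funM => //; exact: measurable_inv_ge0.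
have ge0_scale (h : R -> R) : measurable_fun setT h -> (forall x, 0 <= h x)%R ->
    \int[F]_x (h x / W x)%:E <= 1 -> \int[F]_x (q * (h x / W x))%:E <= q%:E.
  move=> mh h0 h1; under eq_integral do rewrite EFinM.
  rewrite ge0_integralZl//.
  - by rewrite -[leRHS]mule1 lee_wpmul2l// lee_fin ltW.
  - apply/measurable_EFinP; apply: measurable_funM => //.
    exact: measurable_inv_ge0.
  - by move=> x _; rewrite lee_fin divr_ge0.
  - by rewrite lee_fin ltW.
have gq : \int[F]_x (g x)%:E <= q%:E.
  under eq_integral do rewrite -[g _]/(q / W _)%R -[(W _)^-1%R]mul1r.
  apply: ge0_scale => //.
  have := ratio 0%R; rewrite lexx ler01 => /(_ isT); apply: le_trans.
  rewrite le_eqVlt; apply/orP; left; apply/eqP.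
  by apply: eq_integral => x _; rewrite /wealth subr0 mul0r addr0.
have Sq : \int[F]_x ((S x)%:E * (g x)%:E) <= q%:E.
  under eq_integral do rewrite -EFinM /g mulrCA.
  apply: ge0_scale => //.
  have := ratio 1%R; rewrite lexx ler01 => /(_ isT); apply: le_trans.
  rewrite le_eqVlt; apply/orP; left; apply/eqP.
  by apply: eq_integral => x _; rewrite /wealth subrr add0r mul1r.
have g1 : \int[F]_x (g x)%:E <= 1 by apply: (le_trans gq); rewrite lee_fin ltW.
have intg : F.-integrable setT (EFin \o g).
  apply/integrableP; split; first exact/measurable_EFinP.
  under eq_integral do rewrite gee0_abs ?lee_fin//.
  exact: le_lt_trans g1 (ltry _).
have [G GE] := exists_completed_density intg g0 (1%R : R) g1.
set c := fine _ in GE.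
have c0 : (0 <= c)%R by rewrite fine_ge0// sube_ge0 ?orbT.
have Ga : prob_on a G.
  apply/prob_on_setC; have mA : measurable (~` [set x : R | a <= x%:E <= 1]).
    by apply: measurableC; exact: measurable_support.
  have := GE (cst 1) _ mA; rewrite integral_cst// mul1e => ->//.
  rewrite null_set_integral//; last 2 first.
  - by apply: measurable_funTS; apply/measurable_EFinP; apply: measurable_funM.
  - by apply/prob_on_setC.
  rewrite diracE memNset ?mul0e ?mule0 ?adde0//=.
  by apply; rewrite (ltW a1) lexx.
exists G; split => //.
- apply: payoff_lt1_mean => //; first exact: prob_on_le1 Ga.
  have -> := GE (fun x => (S x)%:E) setT measurableT.
  + rewrite /S /payoff subrr mul0r maxxx !mule0 adde0.
    by rewrite (le_lt_trans Sq)// lte_fin.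
  + exact/measurable_EFinP.
  + by move=> x; rewrite lee_fin.
- apply: (@le_trans _ _ (\int[F]_x lne (W x / q)%:E)).
    apply: KL_le_expected_lne.
    + exact: measurable_funM.
    + by move=> x; rewrite divr_ge0// ltW.
    + move=> A mA; have mWq : measurable_fun setT (fun x => (W x / q)%:E).
        by apply/measurable_EFinP; exact: measurable_funM.
      have Wq0 x : 0 <= (W x / q)%:E by rewrite lee_fin divr_ge0// ltW.
      rewrite (GE _ _ mA (measurable_funTS mWq) Wq0).
      (* W / q and g are inverse to each other where W > 0, that is F-almost
         everywhere. *)
      have -> : F A = \int[F]_(x in A) ((W x / q)%:E * (g x)%:E).
        transitivity (\int[F]_(x in A) 1).
          by rewrite integral_cst// mul1e.
        apply: ae_eq_integral => //.
          apply: measurable_funTS; apply: emeasurable_funM => //.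
          exact/measurable_EFinP.
        apply: filterS Wgt0 => x Wx _; rewrite -EFinM /g; congr (_%:E).
        by field; rewrite !gt_eqF.
      by rewrite leeDl// mule_ge0// mule_ge0.
  have intlW : F.-integrable setT (fun x => lne (W x)%:E).
    apply: integrable_lne_wealth => //; apply: lt_le_trans (ltNyr 0) _.
    exact: log_optimal_growth_ge0 t_opt.
  have intq : F.-integrable setT (EFin \o cst (ln q)).
    exact: finite_measure_integrable_cst.
  have -> : growth F S t - (ln q)%:E = \int[F]_x (lne (W x)%:E - (ln q)%:E).
    by rewrite integralB// integral_cst//= probability_setT mule1.
  apply: ae_le_integral.
  + apply: (measurableT_comp (@measurable_lne R setT)) => //.
    by apply/measurable_EFinP; exact: measurable_funM.
  + exact: measurable_int (integrableB measurableT intlW intq).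
  + apply: filterS Wgt0 => x Wx.
    have Wq : (0 < W x / q)%R by rewrite divr_gt0.
    by rewrite (lne_EFin Wq) (lne_EFin Wx) -EFinB lee_fin ln_div ?posrE.
Qed.

End duality.

(** * Both infima for an arbitrary level *)

Lemma mean_le1 (R : realType) (Q : probability R R) :
  prob_on -oo Q -> mean Q <= 1.
Proof.
move=> Qle; have -> : 1 = \int[Q]_x (cst 1 x) :> \bar R.
  by rewrite integral_cst//= probability_setT mule1.
rewrite /mean unlock; apply: ae_le_integral; first exact: EFin_measurable.
  exact: measurable_cst.
by apply: filterS (prob_on_le1 Qle) => x x1; rewrite /= lee_fin.
Qed.

Lemma Dinf_ge1 (R : realType) (F : probability R R) (mu : R) (a : \bar R) :
  (1 <= mu)%R -> Dinf F mu (prob_on a) = +oo.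
Proof.
move=> mu1; rewrite /Dinf (_ : [set G | _ /\ _] = set0).
  by rewrite image_set0 ereal_inf0.
apply/seteqP; split => // G /= [Ga muG].
have := mean_le1 (prob_on_ninfty Ga); rewrite leNgt => /negP; apply.
by apply: le_lt_trans muG; rewrite lee_fin.
Qed.

Unset Implicit Arguments.

Theorem theorem3 (R : realType) (a : \bar R) (ha : a < 1)
    (F : probability R R) (hF : prob_on a F)
    (hmgf : \forall t \near (0%R : R), 'M_F (idfun : R -> R) t < +oo)
    (mu : R) :
  Dinf F mu (prob_on a) = Dinf F mu (prob_on -oo) /\
  ((mu < 1)%R ->
    Lvalues F mu (Lmax F mu) /\
    Dinf F mu (prob_on -oo) = Lmax F mu).
Proof.
have [mu1|mu1] := ltP mu 1%R; last by rewrite !Dinf_ge1.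
have F1 := prob_on_le1 hF.
have intS := integrable_payoff mu1 hmgf.
have [t t01 t_opt] := exists_log_optimal (@payoff_ge0 R mu) intS.
have [tL LmaxE] := log_optimal_Lmax mu1 F1 intS t01 t_opt.
have Lmax_le b : prob_on b F -> Lmax F mu <= Dinf F mu (prob_on b).
  move=> Fb; apply: le_ereal_inf_tmp => _ [G [Gb Gmu] <-]; rewrite LmaxE.
  exact: growth_le_KL (prob_on_le1 Gb) Gmu.
have le_Lmax b : b < 1 -> prob_on b F -> Dinf F mu (prob_on b) <= Lmax F mu.
  move=> b1 Fb; apply/lee_addgt0Pr => e e0; rewrite LmaxE.
  (* The choice q = exp(- e) makes the loss - log q equal to e. *)
  have q01 : (0 < expR (- e) < 1)%R by rewrite expR_gt0 expR_lt1 oppr_lt0.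
  have [G [Gb Gmu]] := exists_near_optimal mu1 intS b1 Fb t01 t_opt q01.
  rewrite expRK EFinN oppeK; apply: le_trans.
  by apply: ereal_inf_lbound; exists G.
have DE b : b < 1 -> prob_on b F -> Dinf F mu (prob_on b) = Lmax F mu.
  by move=> b1 Fb; apply/eqP; rewrite eq_le le_Lmax// Lmax_le.
have hFoo := prob_on_ninfty hF.
rewrite (DE a)// (DE -oo) ?ltNyr//; split => // _; split => //.
by rewrite LmaxE.
Qed.
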